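(* Let $F:\mathbb{R}^p\times\mathbb{R}^m\to\mathbb{R}^p$ be locally Lipschitz and path differentiable, jointly in $(x,\theta)$, and let $J_F:\mathbb{R}^{p}\times\mathbb{R}^m\rightrightarrows\mathbb{R}^{p\times(p+m)}$ be a conservative Jacobian for $F$. Assume there exists $0\le\rho<1$ such that for every $(x,\theta)\in\mathbb{R}^p\times\mathbb{R}^m$ and every $[A,B]\in J_F(x,\theta)$, with $A\in\mathbb{R}^{p\times p}$ and $B\in\mathbb{R}^{p\times m}$, one has $\|A\|_{\mathrm{op}}\le\rho$. For $\theta\in\mathbb{R}^m$ let $\bar x(\theta)$ be the unique fixed point of $F(\cdot,\theta)$. Then the set-valued map $$J^{\mathrm{pb}}_{\bar x}:\theta\rightrightarrows\mathrm{fix}\left[J_F(\bar x(\theta),\theta)\right]\subset\mathbb{R}^{p\times m}$$ is well-defined, and it is a conservative Jacobian for the fixed point map $\bar x:\mathbb{R}^m\to\mathbb{R}^p$.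
   Context: Conservative Jacobian: for a locally Lipschitz $f:\mathbb{R}^n\to\mathbb{R}^q$, a set-valued map $J:\mathbb{R}^n\rightrightarrows\mathbb{R}^{q\times n}$ is a conservative Jacobian for $f$ if it has closed graph, is locally bounded, is nowhere empty, and for every absolutely continuous $\gamma:[0,1]\to\mathbb{R}^n$, for almost every $t\in[0,1]$, $\frac{d}{dt}f(\gamma(t))=V\dot\gamma(t)$ for all $V\in J(\gamma(t))$. $f$ is path differentiable if it admits a conservative Jacobian. $[A,B]$ is the concatenation of $A$ and $B$; $\|\cdot\|_{\mathrm{op}}$ is the operator norm induced by the Euclidean norm. The contraction hypothesis implies that $F(\cdot,\theta)$ is a strict contraction, so it has a unique fixed point $\bar x(\theta)$. Set-valued fixed point: if $\mathcal{J}\subset\mathbb{R}^{p\times(p+m)}$ is nonempty, compact, and every $[A,B]\in\mathcal{J}$ has $\|A\|_{\mathrm{op}}\le\rho<1$, then $\mathrm{fix}(\mathcal{J})$ denotes the unique nonempty compact set $\mathcal{X}\subset\mathbb{R}^{p\times m}$ with $\mathcal{X}=\{AX+B:[A,B]\in\mathcal{J},X\in\mathcal{X}\}$. *)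

(* Defs.v *)
From mathcomp Require Export all_boot all_order all_algebra.
From mathcomp Require Export all_classical all_reals all_analysis.
Export Order.TTheory GRing.Theory Num.Theory.
Export numFieldNormedType.Exports.

Set Implicit Arguments.
Unset Strict Implicit.
Unset Printing Implicit Defensive.

#[global] Open Scope classical_set_scope.
#[global] Open Scope ring_scope.

(* R^n is 'cV[R]_n and R^p x R^m is identified with R^(p+m) through col_mx.
   Topology, boundedness, Lipschitz continuity and absolute continuity refer
   to the library's max norm on matrices, which is equivalent to the Euclidean
   norm; only opnorm, where constants matter, is built on the Euclidean norm. *)

Definition enorm (R : realType) (n : nat) (x : 'cV[R]_n) : R :=
  Num.sqrt (\sum_(i < n) x i 0 ^+ 2).

(* Over the closed unit ball rather than the sphere, so that the set is
   nonempty also for n = 0. *)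
Definition opnorm (R : realType) (m n : nat) (A : 'M[R]_(m, n)) : R :=
  sup [set enorm (A *m x) | x in [set x : 'cV[R]_n | enorm x <= 1]].

Definition locally_lipschitz (R : realType) (n q : nat)
    (f : 'cV[R]_n -> 'cV[R]_q) : Prop :=
  forall x : 'cV[R]_n, exists2 U, nbhs x U & [lipschitz f y | y in U].

(* Degenerate intervals (a i = b i) are allowed and contribute nothing. *)
Definition abs_continuous (R : realType) (n : nat) (c d : R)
    (g : R -> 'cV[R]_n) : Prop :=
  forall e : R, 0 < e -> exists2 delta : R, 0 < delta &
    forall (k : nat) (a b : 'I_k -> R),
      (forall i, [/\ c <= a i, a i <= b i & b i <= d]) ->
      trivIset setT (fun i => `]a i, b i[%classic) ->
      \sum_(i < k) (b i - a i) < delta ->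
      \sum_(i < k) `|g (b i) - g (a i)| < e.

(* Curves on [0, 1] are represented by total functions on R; their values
   outside [0, 1] only affect derivability at the null set {0, 1}.
   The chain rule is read as asserting that both derivatives exist: 'D_1 is a
   total operator, so the bare equation would not say so. *)
Definition chain_rule_along_curves (R : realType) (n q : nat)
    (f : 'cV[R]_n -> 'cV[R]_q) (J : 'cV[R]_n -> set 'M[R]_(q, n)) : Prop :=
  forall g : R -> 'cV[R]_n, abs_continuous 0 1 g ->
    {ae lebesgue_measure, forall t : R, t \in `[0, 1] ->
      [/\ derivable g t 1, derivable (f \o g) t 1 &
          forall V, J (g t) V -> 'D_1 (f \o g) t = V *m 'D_1 g t]}.

Definition conservative_jacobian (R : realType) (n q : nat)
    (f : 'cV[R]_n -> 'cV[R]_q) (J : 'cV[R]_n -> set 'M[R]_(q, n)) : Prop :=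
  [/\ locally_lipschitz f,
      closed [set xV : 'cV[R]_n * 'M[R]_(q, n) | J xV.1 xV.2],
      forall x : 'cV[R]_n, exists2 U, nbhs x U & bounded_set (\bigcup_(y in U) J y),
      forall x, J x !=set0 &
      chain_rule_along_curves f J].

Definition path_differentiable (R : realType) (n q : nat)
    (f : 'cV[R]_n -> 'cV[R]_q) : Prop :=
  exists J, conservative_jacobian f J.

Definition fix_domain (R : realType) (p m : nat)
    (J : set 'M[R]_(p, p + m)) : Prop :=
  [/\ J !=set0, compact J &
      exists2 rho : R, rho < 1 &
        forall A B, J (row_mx A B) -> opnorm A <= rho].

Definition is_fix (R : realType) (p m : nat)
    (J : set 'M[R]_(p, p + m)) (X : set 'M[R]_(p, m)) : Prop :=
  [/\ X !=set0, compact X &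
      X = [set Y | exists A B Z, [/\ J (row_mx A B), X Z & Y = A *m Z + B]]].

(* Only meaningful on fix_domain, where is_fix J has exactly one solution. *)
Definition fix_set (R : realType) (p m : nat)
    (J : set 'M[R]_(p, p + m)) : set 'M[R]_(p, m) :=
  xget set0 [set X | is_fix J X].

(* Main.v *)
Require Import Defs.
From mathcomp Require Import ring lra measurable_realfun.
Set Implicit Arguments.
Unset Strict Implicit.
Unset Printing Implicit Defensive.

(* Integrating the chain rule along segments in the x-variable (a mean value
   inequality for curves differentiable almost everywhere) shows that
   F(., theta) is a rho-contraction for the Euclidean norm, whence xbar exists
   and inherits local Lipschitz continuity from F. The set fix(J) is the
   largest bounded X with X `<=` {A Z + B | [A, B] in J, Z in X}; closedness of
   the graph follows, since the limits of the elements of neighbouring fixed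
   sets again form a bounded set with this property. For the chain rule, put
   h = xbar o gamma: F (h, gamma) = h gives h' = A h' + B gamma' for all
   [A, B] in J, so X = A X1 + B implies
   X gamma' - h' = A (X1 gamma' - h'), and iterating forces X gamma' = h'. *)

(** * Euclidean and operator norms *)

Section matrix_norm.
Variables (R : realType) (m n : nat).
Implicit Types (A : 'M[R]_(m, n)).

Lemma mx_entry_le_norm A i j : `|A i j| <= `|A|.
Proof.
by rewrite [leRHS]/Num.Def.normr/= mx_normrE;
  exact: (le_bigmax _ _ (i, j)).
Qed.

Lemma mx_norm_le A c : 0 <= c -> (forall i j, `|A i j| <= c) -> `|A| <= c.
Proof.
by move=> c0 Ac; rewrite [leLHS]/Num.Def.normr/= mx_normrE bigmax_le.
Qed.

End matrix_norm.

Section euclidean_norm.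
Variable R : realType.

Lemma ler_sum_const n (f : 'I_n -> R) c :
  (forall i, f i <= c) -> \sum_(i < n) f i <= n%:R * c.
Proof.
move=> fc; rewrite mulr_natl -[n in leRHS]card_ord -sumr_const.
by apply: ler_sum => i _.
Qed.

Lemma enorm_ge0 n (x : 'cV[R]_n) : 0 <= enorm x.
Proof. exact: sqrtr_ge0. Qed.

Lemma sqr_enorm n (x : 'cV[R]_n) : enorm x ^+ 2 = \sum_(i < n) x i 0 ^+ 2.
Proof. by rewrite sqr_sqrtr// sumr_ge0// => i _; exact: sqr_ge0. Qed.

Lemma enorm0 n : enorm (0 : 'cV[R]_n) = 0.
Proof. by rewrite /enorm big1 ?sqrtr0// => i _; rewrite mxE expr0n. Qed.

Lemma enormZ n (a : R) (x : 'cV[R]_n) : enorm (a *: x) = `|a| * enorm x.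
Proof.
rewrite /enorm (eq_bigr (fun i => a ^+ 2 * x i 0 ^+ 2)); last first.
  by move=> i _; rewrite mxE exprMn.
by rewrite -mulr_sumr sqrtrM ?sqr_ge0// sqrtr_sqr.
Qed.

Lemma enormN n (x : 'cV[R]_n) : enorm (- x) = enorm x.
Proof. by rewrite -scaleN1r enormZ normrN1 mul1r. Qed.

Lemma enormB n (x y : 'cV[R]_n) : enorm (x - y) = enorm (y - x).
Proof. by rewrite -enormN opprB. Qed.

Lemma norm_le_enorm n (x : 'cV[R]_n) : `|x| <= enorm x.
Proof.
apply: mx_norm_le; first exact: enorm_ge0.
move=> i j; rewrite ord1 -sqrtr_sqr ler_sqrt; last first.
  by apply: sumr_ge0 => k _; exact: sqr_ge0.
by rewrite (bigD1 i)//= lerDl sumr_ge0// => k _; exact: sqr_ge0.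
Qed.

Lemma enorm_le_norm n (x : 'cV[R]_n) : enorm x <= Num.sqrt n%:R * `|x|.
Proof.
rewrite -[`|x|]ger0_norm// -sqrtr_sqr -sqrtrM// ler_sqrt; last first.
  by rewrite mulr_ge0// sqr_ge0.
apply: ler_sum_const => i.
by rewrite -[leLHS]real_normK ?num_real// lerXn2r ?nnegrE// mx_entry_le_norm.
Qed.

Lemma enorm_eq0 n (x : 'cV[R]_n) : enorm x = 0 -> x = 0.
Proof.
by move=> x0; apply/eqP; rewrite -normr_le0 -x0 norm_le_enorm.
Qed.

(** Once both norms are nonzero, multiplying by [2 * (enorm x * enorm y)] reduces the claim to the
    nonnegativity, term by term, of the square of [enorm y * x i 0 - enorm x * y i 0]. *)
Lemma cauchy_schwarz n (x y : 'cV[R]_n) :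
  \sum_(i < n) x i 0 * y i 0 <= enorm x * enorm y.
Proof.
have [x0|xN0] := eqVneq (enorm x) 0.
  rewrite x0 mul0r (enorm_eq0 x0) big1// => i _.
  by rewrite mxE mul0r.
have [y0|yN0] := eqVneq (enorm y) 0.
  rewrite y0 mulr0 (enorm_eq0 y0) big1// => i _.
  by rewrite mxE mulr0.
have xy0 : 0 < enorm x * enorm y by rewrite mulr_gt0// lt0r ?xN0 ?yN0 enorm_ge0.
rewrite -(ler_pM2l xy0) -(ler_pM2l (ltr0n R 2)) mulr_sumr mulr_sumr.
have -> : 2 * (enorm x * enorm y * (enorm x * enorm y)) =
    \sum_(i < n) (enorm y ^+ 2 * x i 0 ^+ 2 + enorm x ^+ 2 * y i 0 ^+ 2).
  by rewrite big_split/= -!mulr_sumr -!sqr_enorm; ring.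
apply: ler_sum => i _.
have := sqr_ge0 (enorm y * x i 0 - enorm x * y i 0); lra.
Qed.

Lemma ler_enormD n (x y : 'cV[R]_n) : enorm (x + y) <= enorm x + enorm y.
Proof.
rewrite -(@ler_pXn2r _ 2)// ?nnegrE ?addr_ge0 ?enorm_ge0//.
rewrite sqrrD !sqr_enorm -addrA.
under eq_bigr do rewrite mxE sqrrD -addrA.
rewrite big_split/= lerD2l big_split/= lerD2r.
by rewrite sumrMnl lerMn2r/= cauchy_schwarz.
Qed.

Lemma ler_enorm_dist n (z x y : 'cV[R]_n) :
  enorm (x - y) <= enorm (x - z) + enorm (z - y).
Proof. by rewrite -[x - y](subrKA z) ler_enormD. Qed.

Lemma ler_enorm_mulmx m n (A : 'M[R]_(m, n)) (x : 'cV[R]_n) :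
  enorm (A *m x) <= opnorm A * enorm x.
Proof.
have [x0|xN0] := eqVneq (enorm x) 0.
  by rewrite x0 mulr0 (enorm_eq0 x0) mulmx0 enorm0.
have x_gt0 : 0 < enorm x by rewrite lt0r xN0 enorm_ge0.
rewrite -ler_pdivrMr// mulrC -[X in X * _]ger0_norm ?invr_ge0 ?enorm_ge0//.
rewrite -enormZ scalemxAr; apply: ub_le_sup; last first.
  exists ((enorm x)^-1 *: x) => //=.
  by rewrite enormZ ger0_norm ?invr_ge0 ?enorm_ge0// mulVf.
(* Boundedness of the set under [sup]: entries of [y] are at most 1 in absolute value, so those of
   [A *m y] are at most [n] times the norm of [A]; the return to the Euclidean norm costs
   [Num.sqrt m%:R]. *)
exists (Num.sqrt m%:R * (n%:R * `|A|)) => _ [y /= y1 <-].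
apply: le_trans (enorm_le_norm _) _; rewrite ler_wpM2l ?sqrtr_ge0//.
apply: mx_norm_le => [|i j]; first by rewrite mulr_ge0.
rewrite mxE (le_trans (ler_norm_sum _ _ _))//.
apply: ler_sum_const => k.
rewrite normrM -[leRHS]mulr1 ler_pM ?mx_entry_le_norm//.
by rewrite (le_trans (mx_entry_le_norm _ _ _))// (le_trans (norm_le_enorm _)).
Qed.

Lemma opnorm_ge0 m n (A : 'M[R]_(m, n)) : 0 <= opnorm A.
Proof.
rewrite /opnorm; set S := [set _ | _ in _].
(* By convention [sup] is 0 on a set without supremum, so boundedness need not be checked again. *)
have [hs|nhs] := pselect (has_sup S); last by rewrite sup_out.
apply: ub_le_sup; first by case: hs.
by exists 0; rewrite /= ?mulmx0 enorm0.
Qed.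

End euclidean_norm.

(** * Matrix-valued maps and compactness *)

Lemma bounded_setP (K : realFieldType) (V : normedModType K) (A : set V) :
  bounded_set A <-> exists M : K, forall x, A x -> `|x| <= M.
Proof.
split=> [[M [_ AM]]|[M AM]].
  by exists (M + 1) => x Ax; apply: AM => //; rewrite ltrDl.
by exists M; split; [exact: num_real|move=> y My x Ax;
  exact: le_trans (AM _ Ax) (ltW My)].
Qed.

Lemma continuous_mx (R : realType) (T : topologicalType) m n
    (f : T -> 'M[R]_(m, n)) :
  (forall i j, continuous (fun x => f x i j)) -> continuous f.
Proof.
move=> fc x A [P fP PA].
suff : \forall y \near x, forall i j, P i j (f y i j).
  by apply: filterS => y; exact: PA.
apply: filter_forall => i; apply: filter_forall => j.
exact: (fc i j x _ (fP i j)).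
Qed.

Lemma continuous_mulmx (R : realType) (T : topologicalType) m n k
    (f : T -> 'M[R]_(m, n)) (g : T -> 'M[R]_(n, k)) :
  continuous f -> continuous g -> continuous (fun x => f x *m g x).
Proof.
move=> fc gc; apply: continuous_mx => i j.
under eq_fun do rewrite mxE.
apply: continuous_big => [x|l _ x]; first exact: add_continuous.
apply: continuousM.
  by apply: (@continuous_comp _ _ _ f (fun M : 'M[R]_(m, n) => M i l));
    [exact: fc|exact: coord_continuous].
by apply: (@continuous_comp _ _ _ g (fun M : 'M[R]_(n, k) => M l j));
  [exact: gc|exact: coord_continuous].
Qed.

(** Heine-Borel for row vectors, transported along the continuous bijection [vec_mx]. *)
Lemma bounded_closed_compact_mx (R : realType) m n (A : set 'M[R]_(m, n)) :
  bounded_set A -> closed A -> compact A.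
Proof.
move=> /bounded_setP[M AM] Acl.
have vc : continuous (@vec_mx R m n).
  by apply: continuous_mx => i j; under eq_fun do rewrite mxE;
    exact: coord_continuous.
have -> : A = vec_mx @` (vec_mx @^-1` A).
  rewrite image_preimage//; apply/seteqP; split => // x _.
  by exists (mxvec x) => //; exact: mxvecK.
apply: continuous_compact; first exact: continuous_subspaceT.
apply: bounded_closed_compact; last by move/continuous_closedP: vc; exact.
apply/bounded_setP; exists `|M| => x /= /AM xM.
apply: mx_norm_le => // i j; rewrite ord1.
case: (mxvec_indexP j) => k l; rewrite -[x]vec_mxK mxvecE.
by rewrite (le_trans (mx_entry_le_norm _ _ _))// (le_trans xM)// ler_norm.
Qed.

(* The closed-projection property of a compact factor, localised at [x]: the
   fibres of [E] over points near [x] have a cluster point. *)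
Lemma closure_proj (X Y : topologicalType) (E : set (X * Y)) (K : set Y) x :
  compact K -> (\forall x' \near x, forall y, E (x', y) -> K y) ->
  closure (fst @` E) x -> exists y, closure E (x, y).
Proof.
move=> Kc EK clx.
pose F := filter_from (nbhs x) (fun N =>
  [set y | exists2 x', N x' & E (x', y)]).
(* Properness says that every neighbourhood of [x] meets the projection of [E], which is the closure
   hypothesis. *)
have FF : ProperFilter F.
  apply: filter_from_proper; last first.
    by move=> N /clx[_ [[[x' y] Exy <-] Nx']]; exists y, x'.
  apply: filter_from_filter; first by exists setT; exact: filterT.
  move=> M N xM xN; exists (M `&` N); first exact: filterI.
  by move=> y [x' [Mx' Nx'] Exy]; split; exists x'.
have FK : F K by exists [set x' | forall y, E (x', y) ->
  K y] => // y [x'] /[apply].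
have [y [Ky Fy]] := Kc F FF FK.
exists y => N [[N1 N2] [/= xN1 yN2] N12].
have FN : F [set y | exists2 x', N1 x' & E (x', y)] by exists N1.
by have [y' [[x' N1x' Exy] N2y']] := Fy _ _ FN yN2; exists (x', y');
  split => //; exact: N12.
Qed.

(** * A mean value inequality *)

(** Let [c] be the supremum of the points [t] with [Q a t]. The local hypothesis at [c] joins some
    such [t] just below [c] to a point beyond [c], unless [c] is already [b]. *)
Lemma cousin (R : realType) (a b : R) (Q : R -> R -> Prop) : a <= b ->
  (forall x y z, a <= x -> x <= y -> y <= z -> z <= b -> Q x y -> Q y z ->
    Q x z) ->
  (forall t, a <= t <= b -> exists2 e, 0 < e & forall x y,
    a <= x -> x <= t -> t <= y -> y <= b -> y - x < e -> Q x y) ->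
  Q a b.
Proof.
move=> ab Qtrans Qloc.
pose S := [set t | a <= t <= b /\ Q a t].
have Sa : S a.
  split; first by rewrite lexx.
  have [|e e0] := Qloc a; first by rewrite lexx.
  by apply => //; rewrite subrr.
have Sb : ubound S b by move=> t [/andP[]].
have hS : has_sup S by split; [exists a | exists b].
pose c := sup S.
have ac : a <= c by apply: ub_le_sup => //; exists b.
have cb : c <= b by apply: ge_sup => //; exists a.
have [|e e0 Qc] := Qloc c; first by rewrite ac.
have [t [/andP[at_ tb] Qat] ct] := sup_adherent e0 hS.
have tc : t <= c by apply: ub_le_sup; [exists b | split => //; rewrite at_].
(* Going past [c] by half of the slack [e - (c - t)] keeps [d - t] below [e]. *)
pose d := Num.min b (c + (e - (c - t)) / 2).
have cd : c <= d by rewrite /d le_min cb /=; move: ct; rewrite -/c; lra.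
have db : d <= b by rewrite /d ge_min lexx.
have de : d <= c + (e - (c - t)) / 2 by rewrite /d ge_min lexx orbT.
have Qad : Q a d.
  apply: (Qtrans a t d) => //; first exact: le_trans tc cd.
  by apply: Qc => //; move: ct; rewrite -/c; lra.
have dc : d <= c.
  apply: ub_le_sup; first by exists b.
  by split => //; rewrite (le_trans ac cd).
have : d = b.
  have : c + (e - (c - t)) / 2 > c by move: ct; rewrite -/c; lra.
  by move: dc; rewrite /d ge_min => /orP[bc|];
    [rewrite min_l // (le_trans bc)//|]; lra.
by move=> <-.
Qed.

Lemma derive_enorm_le (R : realType) n (h : R -> 'cV[R]_n) (t M e : R) :
  0 < e -> derivable h t 1 -> enorm ('D_1 h t) <= M ->
  exists2 d, 0 < d & forall u, `|u - t| < d ->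
    enorm (h u - h t) <= (M + e) * `|u - t|.
Proof.
move=> e0 dh DM.
(* The difference quotient converges in the max norm; [c] absorbs the factor to the Euclidean norm,
   and the [+ 1] keeps the divisor positive for [n = 0]. *)
pose c := e / (Num.sqrt n%:R + 1).
have s0 : 0 < Num.sqrt n%:R + 1 :> R by rewrite ltr_wpDl// sqrtr_ge0.
have c0 : 0 < c by rewrite divr_gt0.
have /cvgrPdist_le/(_ _ c0)[d /= d0 dP] := dh.
exists d => // u ud.
have [->|ut] := eqVneq u t; first by rewrite !subrr enorm0 normr0 mulr0.
have ut0 : u - t != 0 by rewrite subr_eq0.
have := dP (u - t).
rewrite /ball_/= sub0r normrN => /(_ ud ut0).
rewrite -[(u - t)%R *: 1]/((u - t) * 1) mulr1 subrK => Hd.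
have -> : h u - h t = (u - t) *: ((u - t)^-1 *: (h u - h t)).
  by rewrite scalerA mulfV// scale1r.
rewrite enormZ mulrC ler_wpM2r//.
apply: le_trans (_ : enorm ('D_1 h t) +
    enorm ((u - t)^-1 *: (h u - h t) - 'D_1 h t) <= _).
  by rewrite -[in leLHS](subrK ('D_1 h t) (_ *: _)) addrC ler_enormD.
rewrite lerD//.
apply: le_trans (enorm_le_norm _) _.
rewrite distrC (le_trans (ler_wpM2l _ Hd)) ?sqrtr_ge0//.
by rewrite /c mulrCA ger_pMr// ler_pdivrMr// mul1r lerDl.
Qed.

(* The exceptional null set is covered by an open U of small measure, on which
   increments are charged, through the Lipschitz constant, to the measure of U;
   Cousin's lemma then replaces integration of the derivative. *)
Lemma enorm_increment_le (R : realType) n (h : R -> 'cV[R]_n) (a b d L M : R) :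
  a <= b -> 0 < d -> 0 <= L -> 0 <= M ->
  (forall s t, a <= s -> s <= t -> t <= b -> t - s < d ->
    enorm (h t - h s) <= L * (t - s)) ->
  {ae lebesgue_measure, forall t : R, t \in `[a, b] ->
    derivable h t 1 /\ enorm ('D_1 h t) <= M} ->
  enorm (h b - h a) <= M * (b - a).
Proof.
move=> ab d0 L0 M0 hL [N [mN N0 badN]].
(* A single [e] serves as slope error and as bound on the measure of the cover, for a total error of
   [(b - a + L) * e]. *)
suff key e : 0 < e -> enorm (h b - h a) <= (M + e) * (b - a) + L * e.
  apply/ler_addgt0Pr => e e0.
  have c0 : 0 < b - a + L + 1 by lra.
  apply: le_trans (key _ (divr_gt0 e0 c0)) _.
  rewrite mulrDl -addrA lerD2l.
  rewrite [L * _]mulrC -mulrDr mulrAC ler_pdivrMr// ler_pM2l//; lra.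
move=> e0.
have [|U [oU NU UNe]] := lebesgue_regularity_outer mN _ e0.
  by rewrite [X in (X < _)%E]N0.
have mU : measurable U by exact: open_measurable.
have Ue : (lebesgue_measure U < e%:E)%E.
  apply: le_lt_trans UNe.
  rewrite -[leLHS](_ : lebesgue_measure ((U `\` N) `|` N) = _)%E; last first.
    by rewrite setUC setDUK.
  rewrite measureU//; last 2 first.
  - exact: measurableD.
  - by rewrite setDKI.
  by rewrite [X in (_ + X)%E]N0 adde0.
(* Half-open intervals make [w] exactly additive over adjacent intervals, hence [Q] below
   transitive. *)
pose w x y := lebesgue_measure (U `&` `]x, y]).
have w_fin x y : w x y \is a fin_num.
  rewrite ge0_fin_numE//; apply: le_lt_trans (lt_trans Ue (ltry _)).
  by apply: le_measure; rewrite ?inE//; exact: measurableI.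
have wE x y : x <= y -> `]x, y] `<=` U -> w x y = (y - x)%:E.
  move=> xy xyU; rewrite /w setIidr// lebesgue_measure_itv/= lte_fin.
  by case: ltgtP xy => // -> _; rewrite subrr.
have wD x y z : x <= y -> y <= z -> w x z = (w x y + w y z)%E.
  move=> xy yz; rewrite /w -measureU//.
  - by rewrite -setIUr -itv_bndbnd_setU// ?bnd_simp.
  - exact: measurableI.
  - exact: measurableI.
  - apply/seteqP; split => // u [[_ +] [_]] /=; rewrite !in_itv/=.
    by move=> /andP[_ uy] /andP[yu _]; move: (lt_le_trans yu uy); rewrite ltxx.
pose Q x y := enorm (h y - h x) <= (M + e) * (y - x) + L * fine (w x y).
suff Qab : Q a b.
  apply: le_trans Qab _; rewrite lerD2l ler_wpM2l//.
  rewrite -lee_fin fineK//; apply: le_trans (ltW Ue).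
  by apply: le_measure; rewrite ?inE//; exact: measurableI.
apply: (@cousin _ a b Q ab).
  move=> x y z _ xy yz _; rewrite /Q => Qxy Qyz.
  apply: le_trans (ler_enorm_dist (h y) _ _) _.
  rewrite (wD x y z)// fineD//.
  have -> : (M + e) * (z - x) + L * (fine (w x y) + fine (w y z)) =
    ((M + e) * (z - y) + L * fine (w y z)) + ((M + e) * (y - x) + L * fine
      (w x y)).
    by ring.
  exact: lerD.
move=> t /andP[at_ tb].
(* Around a point of [N], short intervals lie in [U], so [w] is their length and pays for the
   Lipschitz bound. Elsewhere the derivative at [t] controls the increments on both sides of [t]. *)
have [tN|tN] := pselect (N t).
  have /nbhs_ballP[r /= r0 rU] : nbhs t U by apply: open_nbhs_nbhs;
    split => //; exact: NU.
  exists (Num.min r d); first by rewrite lt_min r0.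
  move=> x y ax xt ty yb; rewrite lt_min => /andP[yxr yxd].
  have xy := le_trans xt ty.
  rewrite /Q wE//=; last first.
    move=> u /=; rewrite in_itv/= => /andP[xu uy]; apply: rU.
    by rewrite /ball/= ltr_norml; lra.
  apply: le_trans (hL _ _ ax xy yb yxd) _.
  by rewrite lerDr mulr_ge0 ?subr_ge0//; lra.
have [dht DM] : derivable h t 1 /\ enorm ('D_1 h t) <= M.
  apply: contrapT => nP; apply: tN; apply: badN => /= P; apply/nP/P.
  by rewrite in_itv/= at_.
have [r r0 hr] := derive_enorm_le e0 dht DM.
exists r => // x y ax xt ty yb yxr; rewrite /Q.
apply: le_trans (_ : (M + e) * (y - x) <= _); last first.
  by rewrite lerDl mulr_ge0// fine_ge0.
apply: le_trans (ler_enorm_dist (h t) _ _) _.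
have -> : (M + e) * (y - x) = (M + e) * `|y - t| + (M + e) * `|x - t|.
  by rewrite ger0_norm ?subr_ge0// distrC ger0_norm ?subr_ge0//; ring.
rewrite lerD//; first by apply: hr; rewrite ger0_norm ?subr_ge0//; lra.
by rewrite enormB; apply: hr; rewrite distrC ger0_norm ?subr_ge0//; lra.
Qed.

(** * Absolutely continuous curves *)

Lemma norm_col_mx_le (R : realType) p q n (x : 'M[R]_(p, n)) (y :
  'M[R]_(q, n)) :
  `|col_mx x y| <= `|x| + `|y|.
Proof.
apply: mx_norm_le => [|i j]; first exact: addr_ge0.
by rewrite mxE; case: splitP => k _;
  rewrite (le_trans (mx_entry_le_norm _ k j))// ?lerDl ?lerDr.
Qed.

Lemma continuous_col_mx (R : realType) (T : topologicalType) p q n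
    (f : T -> 'M[R]_(p, n)) (g : T -> 'M[R]_(q, n)) :
  continuous f -> continuous g -> continuous (fun x => col_mx (f x) (g x)).
Proof.
move=> fc gc; apply: continuous_mx => i j; under eq_fun do rewrite mxE.
case: (fintype.split i) => k.
  by move=> x; apply: (@continuous_comp _ _ _ f (fun M : 'M[R]_(p, n) =>
    M k j)); [exact: fc|exact: coord_continuous].
by move=> x; apply: (@continuous_comp _ _ _ g (fun M : 'M[R]_(q, n) => M k j));
  [exact: gc|exact: coord_continuous].
Qed.

Lemma locally_lipschitzP (R : realType) n q (f : 'cV[R]_n -> 'cV[R]_q) :
  locally_lipschitz f <->
  forall x : 'cV[R]_n, exists2 L, 0 < L & exists2 U, nbhs x U &
    forall y z, U y -> U z -> `|f y - f z| <= L * `|y - z|.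
Proof.
split=> + x => /(_ x).
  move=> [U xU [M [_ MU]]]; exists (`|M| + 1); first by rewrite ltr_wpDl.
  exists U => // y z Uy Uz; apply: (MU (`|M| + 1) _ (y, z)) => //.
  by rewrite (le_lt_trans (ler_norm M))// ltrDl.
move=> [L _ [U xU LU]]; exists U => //; exists L; split; first exact: num_real.
move=> M LM [y z] [/= Uy Uz]; apply: le_trans (LU _ _ Uy Uz) _.
by rewrite ler_wpM2r// ltW.
Qed.

Section absolutely_continuous_curves.
Variables (R : realType) (c d : R).

(** Uniform continuity is the case of a family of one interval. *)
Lemma abs_continuous_unif n (g : R -> 'cV[R]_n) : abs_continuous c d g ->
  forall e, 0 < e -> exists2 delta, 0 < delta & forall s t,
    c <= s <= d -> c <= t <= d -> `|t - s| < delta -> `|g t - g s| < e.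
Proof.
move=> gac e e0; have [delta delta0 gdelta] := gac e e0.
exists delta => // s t.
wlog st : s t / s <= t.
  move=> W sK tK; have [st|ts] := leP s t; first exact: W.
  by rewrite distrC => std; rewrite distrC; apply: W => //; exact: ltW.
move=> /andP[cs sd] /andP[ct td]; rewrite ger0_norm ?subr_ge0// => std.
have := gdelta 1%N (fun=> s) (fun=> t).
rewrite !big_ord1; apply => //.
by move=> i j _ _ _; rewrite !ord1.
Qed.

Lemma lipschitz_abs_continuous n (g : R -> 'cV[R]_n) L :
  (forall s t, `|g t - g s| <= L * `|t - s|) -> abs_continuous c d g.
Proof.
move=> gL e e0; exists (e / (`|L| + 1)); first by rewrite divr_gt0// ltr_wpDl.
move=> k a b abK _; rewrite ltr_pdivlMr ?ltr_wpDl// => /(le_lt_trans _); apply.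
rewrite mulr_suml; apply: ler_sum => i _; have [_ ab _] := abK i.
apply: le_trans (gL _ _) _; rewrite ger0_norm ?subr_ge0// mulrC.
by rewrite ler_wpM2l ?subr_ge0// (le_trans (ler_norm L))// lerDl.
Qed.

Lemma abs_continuous_col_mx p q (f : R -> 'cV[R]_p) (g : R -> 'cV[R]_q) :
  abs_continuous c d f -> abs_continuous c d g ->
  abs_continuous c d (fun t => col_mx (f t) (g t)).
Proof.
move=> fac gac e e0; have e20 : 0 < e / 2 by rewrite divr_gt0.
have [df df0 fdf] := fac _ e20; have [dg dg0 gdg] := gac _ e20.
exists (Num.min df dg); first by rewrite lt_min df0.
move=> k a b abK tI; rewrite lt_min =>
  /andP[/(fdf _ _ _ abK tI) fe /(gdg _ _ _ abK tI) ge].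
rewrite (splitr e); apply: le_lt_trans (ltrD fe ge).
rewrite -big_split/=; apply: ler_sum => i _.
by rewrite opp_col_mx add_col_mx norm_col_mx_le.
Qed.

(* Compactness of [c, d] makes the local Lipschitz constants uniform along
   the curve; [e] serves both as the radius and as the inverse constant. *)
Lemma locally_lipschitz_curve n q (f : 'cV[R]_n -> 'cV[R]_q)
    (g : R -> 'cV[R]_n) :
  locally_lipschitz f -> abs_continuous c d g ->
  exists2 e, 0 < e & forall s t, c <= s <= d -> c <= t <= d -> `|t - s| < e ->
    `|f (g t) - f (g s)| <= e^-1 * `|g t - g s|.
Proof.
move=> /locally_lipschitzP flip gac.
pose P e s := forall t, c <= t <= d -> `|t - s| < e ->
    `|f (g t) - f (g s)| <= e^-1 * `|g t - g s|.
have : \forall e \near 0^'+, `[c, d] `<=` P e.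
  (* Compactness as a near-covering property: it suffices that, around each [s], all nearby points
     satisfy [P e] for all small [e]. *)
  have /compact_near_coveringP/near_covering_withinP := @segment_compact R c d.
  apply => s.
  rewrite /= in_itv/= => sK.
  have [L L0 [U /nbhs_ballP[r /= r0 rU] LU]] := flip (g s).
  have [delta delta0 gdelta] := abs_continuous_unif gac r0.
  have gU t : c <= t <= d -> `|t - s| < delta -> U (g t).
    move=> tK ts; apply: rU; rewrite -ball_normE/= distrC.
    exact: gdelta.
  near=> s' e => /=; rewrite in_itv/= => s'K t tK ts'.
  have s's : `|s' - s| < delta / 2.
    rewrite distrC; near: s'; apply: nbhsx_ballx; exact: divr_gt0.
  have e0 : 0 < e by near: e; exact: nbhs_right_gt.
  have e1 : e < delta / 2 by near: e; apply: nbhs_right_lt; exact: divr_gt0.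
  have e2 : e < L^-1 by near: e; apply: nbhs_right_lt; rewrite invr_gt0.
  apply: (le_trans (LU _ _ _ _)).
  - apply: gU => //; rewrite (splitr delta) -(subrKA s').
    by rewrite (le_lt_trans (ler_normD _ _))// ltrD// (lt_trans ts').
  - by apply: gU => //; rewrite (lt_trans s's)// ltr_pdivrMr// ltr_pMr// ltr1n.
  - by rewrite ler_wpM2r// -[L]invrK lef_pV2 ?posrE ?invr_gt0// ltW.
move=> nP; near (0:R)^'+ => e.
have e0 : 0 < e by near: e; exact: nbhs_right_gt.
exists e => // s t sK tK.
have : `[c, d] `<=` P e by near: e.
by move=> /(_ s); rewrite /= in_itv/= => /(_ sK); exact.
Unshelve. all: by end_near. Qed.

Lemma abs_continuous_comp n q (f : 'cV[R]_n -> 'cV[R]_q) (g : R -> 'cV[R]_n) :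
  locally_lipschitz f -> abs_continuous c d g -> abs_continuous c d (f \o g).
Proof.
move=> flip gac e e0; have [r r0 fgr] := locally_lipschitz_curve flip gac.
have re0 : 0 < r * e by rewrite mulr_gt0.
have [delta delta0 gdelta] := gac _ re0.
(* The total length dominates each single interval, so the bound by [r] brings every interval within
   the range of the uniform Lipschitz constant. *)
exists (Num.min delta r); first by rewrite lt_min delta0.
move=> k a b abK tI; rewrite lt_min => /andP[/(gdelta _ _ _ abK tI) ge abr].
apply: le_lt_trans (_ : r^-1 * \sum_(i < k) `|g (b i) - g (a i)| < _);
  last first.
  by rewrite ltr_pdivrMl.
rewrite mulr_sumr; apply: ler_sum => i _; have [ca ab bd] := abK i.
apply: fgr; rewrite ?ca ?bd ?andbT//=;
  [exact: le_trans ab bd|exact: le_trans ca ab|].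
rewrite ger0_norm ?subr_ge0//; apply: le_lt_trans abr.
rewrite (bigD1 i)//= lerDl sumr_ge0// => j _.
by have [_ ? _] := abK j; rewrite subr_ge0.
Qed.

End absolutely_continuous_curves.

(** * Fixed sets of affine families *)

(** Every iteration argument below ends with this passage to the limit. No sign is required of [D],
    which is a difference of bounds in one of the uses. *)
Lemma le_geometric_addl (R : realType) (rho D a c : R) : 0 <= rho < 1 ->
  (forall n, a <= rho ^+ n * D + c) -> a <= c.
Proof.
move=> /andP[rho0 rho1] H; apply/ler_addgt0Pl => e e0.
have D1 : 0 < `|D| + 1 by rewrite ltr_wpDl.
have /cvgrPdist_lt/(_ _ (divr_gt0 e0 D1))[N _ /(_ N (leqnn N))] :
    rho ^+ n @[n --> \oo] --> (0 : R).
  by apply: cvg_expr; rewrite ger0_norm.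
rewrite /= sub0r normrN ger0_norm ?exprn_ge0// ltr_pdivlMr// => NE.
apply: le_trans (H N) _; rewrite lerD2r (le_trans _ (ltW NE))//.
by rewrite ler_wpM2l ?exprn_ge0// (le_trans (ler_norm D))// lerDl.
Qed.

Section columns.
Variables (R : realType) (p m : nat).
Implicit Types Z : 'M[R]_(p, m).

Lemma enorm_col_le Z j : enorm (col j Z) <= Num.sqrt p%:R * `|Z|.
Proof.
apply: le_trans (enorm_le_norm _) _; rewrite ler_wpM2l ?sqrtr_ge0//.
by apply: mx_norm_le => // i k; rewrite mxE mx_entry_le_norm.
Qed.

Lemma norm_le_col Z c : 0 <= c -> (forall j, enorm (col j Z) <= c) -> `|Z| <= c.
Proof.
move=> c0 Zc; apply: mx_norm_le => // i j; apply: le_trans (Zc j).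
by apply: le_trans (norm_le_enorm _); have := mx_entry_le_norm (col j Z) i 0;
  rewrite mxE.
Qed.

Lemma enorm_mulmx_le (A : 'M[R]_p) (rho c : R) (x : 'cV[R]_p) :
  opnorm A <= rho -> enorm x <= c -> enorm (A *m x) <= rho * c.
Proof.
move=> Arho xc; apply: le_trans (ler_enorm_mulmx _ _) _.
by apply: ler_pM; rewrite ?opnorm_ge0 ?enorm_ge0.
Qed.

End columns.

Section affine_fixed_sets.
Variables (R : realType) (p m : nat).
Implicit Types (J : set 'M[R]_(p, p + m)) (V : 'M[R]_(p, p + m)).
Implicit Types (S X Y : set 'M[R]_(p, m)) (Z W : 'M[R]_(p, m)).

(** The operator whose nonempty compact fixed points are the solutions of [is_fix J]. Quantifying
    over the whole matrix [V], rather than its blocks, avoids having to recognise a [row_mx]. *)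
Definition affine_step J S : set 'M[R]_(p, m) :=
  [set Y | exists V Z, [/\ J V, S Z & Y = lsubmx V *m Z + rsubmx V]].

Lemma is_fixE J X : is_fix J X <-> [/\ X !=set0,
  compact X & X = affine_step J X].
Proof.
suff E : [set Y | exists A B Z, [/\ J (row_mx A B), X Z & Y = A *m Z + B]] =
    affine_step J X by rewrite -E.
apply/seteqP; split => Y.
  by move=> [A [B [Z [JAB XZ ->]]]]; exists (row_mx A B), Z;
    rewrite row_mxKl row_mxKr.
move=> [V [Z [JV XZ ->]]]; exists (lsubmx V), (rsubmx V), Z.
by rewrite hsubmxK.
Qed.

Lemma affine_step_sub J S S' : S `<=` S' ->
  affine_step J S `<=` affine_step J S'.
Proof.
by move=> SS' Y [V [Z [JV SZ ->]]]; exists V, Z; split => //; exact: SS'.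
Qed.

Lemma col_affine V Z j :
  col j (lsubmx V *m Z + rsubmx V) = lsubmx V *m col j Z + col j (rsubmx V).
Proof. by rewrite linearD/= !colE mulmxA. Qed.

Variables (J : set 'M[R]_(p, p + m)) (rho : R).
Hypothesis rho01 : 0 <= rho < 1.
Hypothesis Jrho : forall V, J V -> opnorm (lsubmx V) <= rho.

(** Bounds are taken column by column in the Euclidean norm, since there left multiplication by the
    first block contracts by [rho]. *)
Lemma affine_step_bound (b c : R) S : (forall V, J V -> `|V| <= b) ->
  (forall Z j, S Z -> enorm (col j Z) <= c) ->
  forall Z j, affine_step J S Z ->
    enorm (col j Z) <= rho * c + Num.sqrt p%:R * b.
Proof.
move=> Jb Sc _ j [V [Z [JV SZ ->]]]; rewrite col_affine.
apply: le_trans (ler_enormD _ _) _; apply: lerD.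
  by apply: enorm_mulmx_le; [exact: Jrho|exact: Sc].
apply: le_trans (enorm_col_le _ _) _; rewrite ler_wpM2l ?sqrtr_ge0//.
apply: le_trans (Jb _ JV); apply: mx_norm_le => // i k.
by rewrite mxE mx_entry_le_norm.
Qed.

(** The radius [r] solves [r = rho * r + Num.sqrt p%:R * b]. Any a priori bound on [S] has its
    excess over [r] multiplied by [rho] at each unrolling, so the final bound depends on [J] only
    through [b]. *)
Lemma affine_invariant_bound (b : R) S : (forall V, J V -> `|V| <= b) ->
  bounded_set S -> S `<=` affine_step J S ->
  forall Z j, S Z -> enorm (col j Z) <= Num.sqrt p%:R * b / (1 - rho).
Proof.
move=> Jb /bounded_setP[M SM] SJS Z j SZ.
have rho1 : 1 - rho != 0 by case/andP: rho01 => ? ?; rewrite subr_eq0 gt_eqF.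
set r := _ / _.
apply: (@le_geometric_addl _ rho (Num.sqrt p%:R * M - r) _ _ rho01) => n.
elim: n Z j SZ => [|n IH] Z j SZ.
  rewrite expr0 mul1r subrK (le_trans (enorm_col_le _ _))//.
  by rewrite ler_wpM2l ?sqrtr_ge0// SM.
apply: le_trans (affine_step_bound Jb IH j (SJS _ SZ)) _.
rewrite le_eqVlt; apply/orP; left; apply/eqP.
by rewrite exprS /r; field.
Qed.

(* Unrolling [x = A x1 + B] along [X] and applying the same pairs [A, B] to an
   arbitrary point of [Y] approximates [x] in [Y] at a geometric rate. *)
Lemma affine_invariant_sub X Y : bounded_set X -> X `<=` affine_step J X ->
  Y !=set0 -> closed Y -> affine_step J Y `<=` Y -> X `<=` Y.
Proof.
move=> /bounded_setP[M XM] XJX [y0 Yy0] Ycl JYY.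
pose D := Num.sqrt p%:R * (`|M| + `|y0|).
have D0 : 0 <= D by rewrite mulr_ge0 ?sqrtr_ge0// addr_ge0.
have approx n x : X x -> exists2 y, Y y & forall j,
  enorm (col j (x - y)) <= rho ^+ n * D.
  elim: n x => [|n IH] x Xx.
    exists y0 => // j; rewrite expr0 mul1r (le_trans (enorm_col_le _ _))//.
    rewrite ler_wpM2l ?sqrtr_ge0// (le_trans (ler_normB _ _))// lerD2r.
    by rewrite (le_trans (XM _ Xx))// ler_norm.
  have [V [x1 [JV Xx1 ->]]] := XJX _ Xx.
  have [y1 Yy1 xy1] := IH _ Xx1.
  exists (lsubmx V *m y1 + rsubmx V); first by apply: JYY; exists V, y1.
  move=> j; rewrite opprD addrACA subrr addr0 -mulmxBr.
  rewrite colE -mulmxA -colE exprS -mulrA.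
  by apply: enorm_mulmx_le => //; exact: Jrho.
move=> x Xx; apply: Ycl => N /nbhs_ballP[e /= e0 eN].
apply: contrapT => /set0P/negP; rewrite negbK => /eqP YN0.
suff : e <= 0 by rewrite leNgt e0.
apply: (@le_geometric_addl _ rho D _ _ rho01) => n; rewrite addr0.
have [y Yy xy] := approx n x Xx.
rewrite leNgt; apply/negP => De.
have : (Y `&` N) y.
  split=> //; apply: eN; rewrite -ball_normE/=; apply: le_lt_trans De.
  apply: norm_le_col => //; rewrite mulr_ge0// exprn_ge0//.
  by case/andP: rho01.
by rewrite YN0.
Qed.

End affine_fixed_sets.

(** * Limits of affine-invariant families *)

Lemma closed_norm_le (R : realType) m n (M : R) :
  closed [set V : 'M[R]_(m, n) | `|V| <= M].
Proof.
apply: (@preimage_closed _ _ (fun V : 'M[R]_(m, n) => `|V|) [set x | x <= M]).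
  by move=> x _; exact: norm_continuous.
exact: closed_le.
Qed.

Lemma closure_image_closed (T U : topologicalType) (f : T -> U)
    (E : set T) (D : set U) z :
  continuous f -> closed D -> (forall x, E x -> D (f x)) ->
  closure E z -> D (f z).
Proof.
move=> /continuous_closedP/[apply] fD ED Ez.
have /closure_id E' := fD; suff : (f @^-1` D) z by [].
by rewrite E'; exact: closureS Ez.
Qed.

Lemma continuous_pair (T U V : topologicalType) (f : T -> U) (g : T -> V) :
  continuous f -> continuous g -> continuous (fun x => (f x, g x)).
Proof. by move=> fc gc z; apply: (cvg_pair (fc z) (gc z)). Qed.

Lemma continuous_affine (R : realType) (T : topologicalType) p m
    (V : T -> 'M[R]_(p, p + m)) (Z : T -> 'M[R]_(p, m)) :
  continuous V -> continuous Z ->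
  continuous (fun t => lsubmx (V t) *m Z t + rsubmx (V t)).
Proof.
move=> Vc Zc t; apply: cvgD; last first.
  suff /(_ t) : continuous (fun t => rsubmx (V t)) by [].
  apply: continuous_mx => i j; under eq_fun do rewrite mxE.
  by move=> s; apply: (@continuous_comp _ _ _ V
    (fun M : 'M[R]_(p, p + m) => M i _)); [exact: Vc|exact: coord_continuous].
apply: (continuous_mulmx _ Zc).
apply: continuous_mx => i j; under eq_fun do rewrite mxE.
by move=> s; apply: (@continuous_comp _ _ _ V
  (fun M : 'M[R]_(p, p + m) => M i _)); [exact: Vc|exact: coord_continuous].
Qed.

Section closed_graph.
Variables (R : realType) (p m : nat) (T : topologicalType).
Variables (J : T -> set 'M[R]_(p, p + m)) (G : set (T * 'M[R]_(p, m))).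

(** Each point of [G] is lifted together with witnesses [V] and [W] of its membership in the step.
    Near [theta] the witnesses stay in a compact set, so a limit of [G] lifts to a limit of such
    tuples, where the closed conditions persist. *)
Lemma closure_affine_invariant (M : R) theta Z :
  closed [set xV | J xV.1 xV.2] ->
  (\forall t \near theta, forall V, J t V -> `|V| <= M) ->
  (\forall t \near theta, forall W, G (t, W) -> `|W| <= M) ->
  (forall t W, G (t, W) -> affine_step (J t) [set W' | G (t, W')] W) ->
  closure G (theta, Z) ->
  affine_step (J theta) [set W | closure G (theta, W)] Z.
Proof.
move=> Jcl JM GM GJ GZ.
pose E : set ((T * 'M[R]_(p, m)) * ('M[R]_(p, p + m) * 'M[R]_(p, m))) :=
  [set z | [/\ J z.1.1 z.2.1, G (z.1.1, z.2.2) &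
             z.1.2 = lsubmx z.2.1 *m z.2.2 + rsubmx z.2.1]].
have GE : G `<=` fst @` E.
  by move=> [t W] /GJ[V [W' [JV GW' ->]]];
    exists ((t, lsubmx V *m W' + rsubmx V), (V, W')).
have Kc : compact ([set V : 'M[R]_(p, p + m) | `|V| <= M] `*`
    [set W : 'M[R]_(p, m) | `|W| <= M]).
  apply: compact_setX; apply: bounded_closed_compact_mx;
    try exact: closed_norm_le;
    by apply/bounded_setP; exists M.
have near1 (P : T -> Prop) : (\forall t \near theta, P t) ->
    \forall z \near (theta, Z), P z.1.
  by move=> thP; exact: (@cvg_fst _ _ (nbhs theta) (nbhs Z) _ P thP).
have [||[V W] EVW] := closure_proj (x := (theta, Z)) (E := E) Kc.
- near=> z => -[V W] [/= JV GW _]; split => /=.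
    by move: V JV; near: z; exact: (near1 (fun t => forall V, J t V ->
      `|V| <= M)).
  by move: W GW; near: z; exact: (near1 (fun t => forall W, G (t, W) ->
    `|W| <= M)).
- exact: closureS GE _ GZ.
pose Q := ((T * 'M[R]_(p, m)) * ('M[R]_(p, p + m) * 'M[R]_(p, m)))%type.
have c11 : continuous (fun z : Q => z.1.1).
  by move=> z; apply: (@continuous_comp _ _ _ fst fst); exact: cvg_fst.
have c12 : continuous (fun z : Q => z.1.2).
  by move=> z; apply: (@continuous_comp _ _ _ fst snd);
    [exact: cvg_fst|exact: cvg_snd].
have c21 : continuous (fun z : Q => z.2.1).
  by move=> z; apply: (@continuous_comp _ _ _ snd fst);
    [exact: cvg_snd|exact: cvg_fst].
have c22 : continuous (fun z : Q => z.2.2).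
  by move=> z; apply: (@continuous_comp _ _ _ snd snd); exact: cvg_snd.
exists V, W; split => /=.
- have c : continuous (fun z : Q => (z.1.1, z.2.1)).
    exact: continuous_pair.
  by apply: (closure_image_closed c Jcl _ EVW) => z [].
- have c : continuous (fun z : Q => (z.1.1, z.2.2)).
    exact: continuous_pair.
  by apply: (closure_image_closed c (@closed_closure _ G) _ EVW) =>
    z [_ /subset_closure].
(* The equation passes to the limit as the closed condition that [d z] has norm at most 0. *)
- pose d (z : Q) := z.1.2 - (lsubmx z.2.1 *m z.2.2 + rsubmx z.2.1).
  have c : continuous d.
    by move=> z; apply: cvgB; [exact: c12|exact: (continuous_affine c21 c22)].
  have /= := closure_image_closed c (@closed_norm_le R p m 0) _ EVW.
  move=> d0; apply/eqP; rewrite -subr_eq0 -normr_le0; apply: d0 => z [_ _ zE].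
  by rewrite /d zE subrr normr0.
Unshelve. all: by end_near. Qed.

End closed_graph.

(** * Existence and uniqueness of the fixed set *)

Section affine_fixed_set.
Variables (R : realType) (p m : nat) (J : set 'M[R]_(p, p + m)) (rho : R).
Hypothesis rho01 : 0 <= rho < 1.
Hypothesis Jrho : forall V, J V -> opnorm (lsubmx V) <= rho.
Hypotheses (J0 : J !=set0) (Jc : compact J).

(** The matrix [1%:M - A] is invertible: a vector fixed by [A] has norm at most [rho] times its own
    norm, hence is zero. The kernel is computed on the transpose because [kermx] acts on row
    vectors. *)
Lemma affine_fixed_point (V : 'M[R]_(p, p + m)) : J V ->
  exists Z, Z = lsubmx V *m Z + rsubmx V.
Proof.
move=> JV; pose A := lsubmx V.
have uA : 1%:M - A \in unitmx.
  rewrite -unitmx_tr -row_free_unit -kermx_eq0;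
    apply/rowV0P => v /sub_kermxP vA.
  have {}vA : v^T = A *m v^T.
    apply/eqP; rewrite -subr_eq0 -[X in X - _]mul1mx -mulmxBl.
    by rewrite -[_ *m _]trmxK trmx_mul trmxK vA trmx0.
  have : enorm v^T <= rho * enorm v^T.
    by rewrite {1}vA; apply: enorm_mulmx_le => //; exact: Jrho.
  have := enorm_ge0 v^T; case/andP: rho01 => rho0 rho1 v0 vr.
  have /enorm_eq0 : enorm v^T = 0 by nra.
  by move=> /(congr1 trmx); rewrite trmxK trmx0.
exists (invmx (1%:M - A) *m rsubmx V).
apply/eqP; rewrite [X in _ == X]addrC -subr_eq -[X in X - _]mul1mx -mulmxBl.
by rewrite mulmxA mulmxV// mul1mx.
Qed.

(* By Knaster-Tarski, the union of all bounded post-fixed points of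
   [affine_step J] is its largest bounded fixed point. *)
Lemma is_fix_exists : exists X, is_fix J X.
Proof.
have [b Jb] : exists b : R, forall V, J V -> `|V| <= b.
  exact/bounded_setP/compact_bounded.
have Jcl : closed J by apply: compact_closed => //; exact: norm_hausdorff.
pose X : set 'M[R]_(p, m) := [set Z |
  exists S : set 'M[R]_(p, m), [/\ bounded_set S, S `<=` affine_step J S & S Z]].
have XJ : X `<=` affine_step J X.
  move=> Z [S [Sb SJ /SJ]]; apply: affine_step_sub => W SW.
  by exists S.
have Xr Z j : X Z -> enorm (col j Z) <= Num.sqrt p%:R * b / (1 - rho).
  by move=> [S [Sb SJ SZ]]; apply: affine_invariant_bound Jb Sb SJ Z j SZ.
have bnd (S : set 'M[R]_(p, m)) r :
    (forall Z j, S Z -> enorm (col j Z) <= r) -> bounded_set S.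
  move=> Sr; apply/bounded_setP; exists `|r| => Z SZ.
  by apply: norm_le_col => // j; rewrite (le_trans (Sr _ _ SZ))// ler_norm.
have JX : affine_step J X `<=` X.
  move=> Z XZ; exists (affine_step J X); split => //.
    exact: bnd (affine_step_bound Jrho Jb Xr).
  exact: affine_step_sub.
have Xb := bnd _ _ Xr; have /bounded_setP[M XM] := Xb.
have Xcl : closed X.
  (* By maximality of [X] it is enough that [closure X] is again bounded and post-fixed. *)
  move=> Z clZ; exists (closure X); split => //.
    apply/bounded_setP; exists M.
    move=> W; apply: (closure_image_closed (f := id) _ (@closed_norm_le R p m M)) => //.
    by move=> x; exact: cvg_id.
  (* A constant family over [R]: at the parameter 0, the result on limits of families becomes a
     statement about [closure X] alone. *)
  pose G : set (R * 'M[R]_(p, m)) := [set tW | X tW.2].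
  have clG W : closure G (0, W) <-> closure X W.
    split.
      apply: (@closure_image_closed _ _ snd G) => [x||x Xx];
        first exact: cvg_snd.
        exact: closed_closure.
      exact: subset_closure.
    move=> clXW N [[N1 N2] [/= N1_0 N2W] N12].
    have [V [XV N2V]] := clXW _ N2W.
    by exists (0, V); split => //; apply: N12; split => //;
      exact: nbhs_singleton N1_0.
  have nJ : \forall t \near (0 : R), forall V, J V -> `|V| <= Num.max b M.
    by near=> t => V JV; rewrite le_max Jb.
  have nG : \forall t \near (0 : R), forall W, G (t, W) -> `|W| <= Num.max b M.
    by near=> t => W XW; rewrite le_max XM ?orbT.
  move=> W clW; suff : affine_step J [set W | closure G (0, W)] W.
    by apply: affine_step_sub => W' /clG.
  apply: (@closure_affine_invariant _ _ _ _ (fun=> J) G (Num.max b M) 0).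
  - have sndc : continuous (snd : R * 'M[R]_(p, p + m) -> 'M[R]_(p, p + m)).
      by move=> x; exact: cvg_snd.
    by move/continuous_closedP : sndc; exact.
  - exact: nJ.
  - exact: nG.
  - by move=> t V /XJ.
  - exact/clG.
exists X; apply/is_fixE; split; last by apply/seteqP.
(* The fixed point of one affine map of the family forms a post-fixed singleton, so it belongs to
   [X]. *)
- have [V JV] := J0; have [Z ZE] := affine_fixed_point JV.
  exists Z, [set Z]; split => //; last by move=> _ ->; exists V, Z.
  exact/compact_bounded/compact_set1.
- exact: bounded_closed_compact_mx.
Unshelve. all: by end_near. Qed.

(** A solution is both bounded and post-fixed, and closed and pre-fixed, so each of two solutions
    contains the other. *)
Lemma is_fix_unique X Y : is_fix J X -> is_fix J Y -> X = Y.
Proof.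
have sub X' Y' : is_fix J X' -> is_fix J Y' -> X' `<=` Y'.
  move=> /is_fixE[_ Xc XE] /is_fixE[Y0 Yc YE].
  apply: (affine_invariant_sub rho01 Jrho) => //.
  - exact: compact_bounded.
  - by rewrite -XE.
  - by apply: compact_closed => //; exact: norm_hausdorff.
  - by rewrite -YE.
by move=> Xf Yf; apply/seteqP; split; exact: sub.
Qed.

Lemma fix_setP : is_fix J (fix_set J).
Proof.
have [X XJ] := is_fix_exists.
exact: (@xgetPex _ set0 [set X | is_fix J X]) (ex_intro _ X XJ).
Qed.

End affine_fixed_set.

(** * The implicit fixed point map *)

Lemma lipschitz_continuous_at (R : realType) (U V : normedModType R)
    (f : U -> V) x (L : R) :
  (\forall y \near x, `|f x - f y| <= L * `|x - y|) -> {for x, continuous f}.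
Proof.
move=> fL; apply/cvgrPdist_lt => e e0.
have L1 : 0 < `|L| + 1 by rewrite ltr_wpDl.
near=> y; apply: (@le_lt_trans _ _ (L * `|x - y|)); first by near: y.
apply: le_lt_trans (_ : (`|L| + 1) * `|x - y| < e).
  by rewrite ler_wpM2r// (le_trans (ler_norm L))// lerDl.
rewrite -ltr_pdivlMl// mulrC; near: y; apply: cvgr_dist_lt;
  last exact: divr_gt0.
exact: cvg_id.
Unshelve. all: by end_near. Qed.

Lemma lipschitz_continuous (R : realType) (U V : normedModType R)
    (f : U -> V) (L : R) :
  (forall x y, `|f x - f y| <= L * `|x - y|) -> continuous f.
Proof.
by move=> fL x; apply: (@lipschitz_continuous_at _ _ _ _ _ L); exact: filterE.
Qed.

Lemma locally_lipschitz_continuous (R : realType) n q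
    (f : 'cV[R]_n -> 'cV[R]_q) :
  locally_lipschitz f -> continuous f.
Proof.
move=> /locally_lipschitzP flip x; have [L L0 [U xU LU]] := flip x.
apply: (@lipschitz_continuous_at R 'cV[R]_n 'cV[R]_q _ _ L).
by have Ux := nbhs_singleton xU; apply: filterS xU => y; exact: LU.
Qed.

Lemma enorm_continuous (R : realType) n : continuous (@enorm R n).
Proof.
apply: (@lipschitz_continuous R 'cV[R]_n R _ (Num.sqrt n%:R)) => x y.
apply: le_trans (enorm_le_norm _).
have tri (u v : 'cV[R]_n) : enorm u <= enorm (u - v) + enorm v.
  by rewrite -{1}(subrK v u) ler_enormD.
by have := tri x y; have := tri y x; rewrite (enormB y x) ler_norml; lra.
Qed.

(** By compactness instead of iteration: a minimiser [x] of [enorm (f x - x)] on an invariant ball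
    is compared with [f x], whose displacement is at most [rho] times as large. *)
Lemma enorm_contraction_fixpoint (R : realType) n
    (f : 'cV[R]_n -> 'cV[R]_n) (rho : R) :
  0 <= rho < 1 -> (forall x y, enorm (f x - f y) <= rho * enorm (x - y)) ->
  exists x, f x = x.
Proof.
move=> /andP[rho0 rho1] fctr.
(* The radius solves [r = rho * r + enorm (f 0)], which makes the ball invariant. *)
pose r := enorm (f 0) / (1 - rho).
pose K := [set x : 'cV[R]_n | enorm x <= r].
have r0 : 0 <= r by rewrite divr_ge0 ?enorm_ge0// subr_ge0 ltW.
have fK x : K x -> K (f x).
  move=> xr; rewrite /K /= -[f x](subrK (f 0)).
  apply: le_trans (ler_enormD _ _) _;
    apply: le_trans (lerD (fctr _ _) (lexx _)) _.
  rewrite subr0; apply: le_trans (lerD (ler_wpM2l rho0 xr) (lexx _)) _.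
  rewrite le_eqVlt; apply/orP; left; apply/eqP.
  by rewrite /r; field; rewrite subr_eq0 gt_eqF.
have Kc : compact K.
  apply: bounded_closed_compact_mx.
    by apply/bounded_setP; exists r => x; apply: le_trans; exact: norm_le_enorm.
  have /continuous_closedP := @enorm_continuous R n.
  by move=> /(_ _ (@closed_le R r)).
have phic : continuous (fun x => enorm (f x - x)).
  have fc : continuous f.
    apply: (@lipschitz_continuous R 'cV[R]_n 'cV[R]_n _
      (rho * Num.sqrt n%:R)) => x y.
    apply: le_trans (norm_le_enorm _) _; apply: le_trans (fctr _ _) _.
    by rewrite -mulrA ler_wpM2l// enorm_le_norm.
  move=> x; apply: (@continuous_comp _ _ _ (fun x => f x - x) (@enorm R n)).
    exact: (cvgB (fc x) (@cvg_id _ (nbhs x))).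
  exact: enorm_continuous.
have [|x xK xmin] := compact_EVT_min (f := fun x =>
  enorm (f x - x)) _ Kc (continuous_subspaceT phic).
  by exists 0; rewrite /K /= enorm0.
exists x; apply/eqP; rewrite -subr_eq0; apply/eqP/enorm_eq0.
have := xmin (f x); rewrite inE =>
  /(_ (fK _ (set_mem xK))) /le_trans /(_ (fctr _ _)).
have := enorm_ge0 (f x - x); nra.
Qed.

Section derive_col_mx.
Variables (R : realType) (V : normedModType R) (p q : nat).
Variables (f : V -> 'cV[R]_p) (g : V -> 'cV[R]_q) (t v : V).

Lemma derivable_col_mx : derivable (fun s => col_mx (f s) (g s)) t v <->
  derivable f t v /\ derivable g t v.
Proof.
have Eu i j : (fun s => col_mx (f s) (g s) (lshift q i) j) = (fun s => f s i j).
  by apply/funext => s; rewrite col_mxEu.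
have Ed i j : (fun s => col_mx (f s) (g s) (rshift p i) j) = (fun s => g s i j).
  by apply/funext => s; rewrite col_mxEd.
split=> [/derivable_mxP D|[/derivable_mxP Df /derivable_mxP Dg]].
  split; apply/derivable_mxP => i j.
    by rewrite -Eu; exact: D.
  by rewrite -Ed; exact: D.
apply/derivable_mxP => i j; case: (split_ordP i) => k ->.
  by rewrite Eu.
by rewrite Ed.
Qed.

Lemma derive_col_mx : derivable f t v -> derivable g t v ->
  'D_v (fun s => col_mx (f s) (g s)) t = col_mx ('D_v f t) ('D_v g t).
Proof.
move=> Df Dg; rewrite !derive_mx//; last exact/derivable_col_mx.
apply/matrixP => i j; rewrite mxE; case: (split_ordP i) => k ->.
  by rewrite col_mxEu mxE; congr ('D_v _ t); apply/funext => s;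
    rewrite col_mxEu.
by rewrite col_mxEd mxE; congr ('D_v _ t); apply/funext => s; rewrite col_mxEd.
Qed.

End derive_col_mx.

Lemma is_derive_line (R : realType) (V : normedModType R) (y w : V) (t : R) :
  is_derive t 1 (fun s : R => y + s *: w) w.
Proof.
have H : h^-1 *: (((fun s : R => y + s *: w) \o shift t) (h *: 1) -
  (y + t *: w))
    @[h --> 0^'] --> w.
  apply: cvg_near_cst; near=> h.
  have h0 : h != 0 by near: h; exact: nbhs_dnbhs_neq.
  rewrite /= opprD addrACA subrr add0r -scalerBl addrK.
  by rewrite [_ *: 1]mulr1 scalerA mulVf// scale1r.
by apply: DeriveDef; [apply/cvg_ex; exists w|exact: cvg_lim H].
Unshelve. all: by end_near. Qed.

(** * Regularity and conservative Jacobian of the fixed point map *)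

Section implicit_fixed_point.
Variables (R : realType) (p m : nat).
Variables (F : 'cV[R]_(p + m) -> 'cV[R]_p)
  (JF : 'cV[R]_(p + m) -> set 'M[R]_(p, p + m)) (rho : R).
Hypotheses (F_JF : conservative_jacobian F JF) (rho01 : 0 <= rho < 1).
Hypothesis JF_contr : forall z V, JF z V -> opnorm (lsubmx V) <= rho.

Let F_lip : locally_lipschitz F. Proof. by case: F_JF. Qed.

(** The segment has velocity [col_mx (x - y) 0], so only the first block of a matrix in [JF] acts in
    the chain rule, and the derivative is at most [rho * enorm (x - y)] almost everywhere. *)
Lemma conservative_jacobian_contraction (x y : 'cV[R]_p) (theta : 'cV[R]_m) :
  enorm (F (col_mx x theta) - F (col_mx y theta)) <= rho * enorm (x - y).
Proof.
have [_ _ _ J0 chain] := F_JF.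
have rho0 : 0 <= rho by case/andP: rho01.
pose l s := y + s *: (x - y).
pose g (s : R) := col_mx (l s) theta.
have gE s t : g t - g s = col_mx ((t - s) *: (x - y)) 0.
  by rewrite opp_col_mx add_col_mx subrr opprD addrACA subrr add0r -scalerBl.
have gL s t : `|g t - g s| <= `|x - y| * `|t - s|.
  by rewrite gE (le_trans (norm_col_mx_le _ _))// normr0 addr0 normrZ mulrC.
have gac := lipschitz_abs_continuous 0 1 gL.
have [e e0 Fe] := locally_lipschitz_curve F_lip gac.
have -> : F (col_mx x theta) = (F \o g) 1.
  by rewrite /= /g /l scale1r addrC subrK.
have -> : F (col_mx y theta) = (F \o g) 0 by rewrite /= /g /l scale0r addr0.
rewrite -[leRHS]mulr1 -[X in _ <= _ * X](subr0 1).
(* The Lipschitz constant combines the change of norm, the constant [e^-1] of [F] along the curve,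
   and the speed of the segment. *)
apply: (@enorm_increment_le _ _ _ _ _ e (Num.sqrt p%:R * (e^-1 * `|x - y|))) =>
  //.
- by rewrite mulr_ge0 ?sqrtr_ge0// mulr_ge0// invr_ge0 ltW.
- by rewrite mulr_ge0// enorm_ge0.
- move=> s t s0 st t1 ts; apply: le_trans (enorm_le_norm _) _.
  rewrite -!mulrA ler_wpM2l ?sqrtr_ge0//.
  apply: (le_trans (Fe s t _ _ _)).
  + by rewrite s0 (le_trans st).
  + by rewrite t1 (le_trans s0).
  + by rewrite ger0_norm ?subr_ge0.
  + rewrite ler_wpM2l ?invr_ge0 ?(ltW e0)//.
    by rewrite -[X in _ * X]ger0_norm ?subr_ge0.
- move: (chain g gac); apply: filterS;
  first exact: (ae_filter_ringOfSetsType lebesgue_measure).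
  move=> t gt /gt[Dg DFg DV]; split => //.
  have [V JV] := J0 (g t); rewrite (DV _ JV).
  have [Dl Dlv] := is_derive_line y (x - y) t.
  rewrite derive_col_mx ?Dlv//.
  rewrite derive_cst -[V]hsubmxK mul_row_col mulmx0 addr0.
  apply: enorm_mulmx_le => //; exact: JF_contr JV.
Qed.

Lemma fixed_point_exists_unique (theta : 'cV[R]_m) :
  exists! x : 'cV[R]_p, F (col_mx x theta) = x.
Proof.
have ctr x y := conservative_jacobian_contraction x y theta.
have [x Fx] := enorm_contraction_fixpoint rho01 ctr.
exists x; split=> // y Fy; apply/eqP; rewrite -subr_eq0; apply/eqP/enorm_eq0.
have := ctr x y; rewrite Fx Fy.
case/andP: rho01 => rho0 rho1; have := enorm_ge0 (x - y); nra.
Qed.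

Variable xbar : 'cV[R]_m -> 'cV[R]_p.
Hypothesis Fxbar : forall theta, F (col_mx (xbar theta) theta) = xbar theta.

(** The triangle inequality through [F (col_mx (xbar s) t)] leaves [rho] times the left side on the
    right, to be absorbed. *)
Lemma fixed_point_dist (t s : 'cV[R]_m) : `|xbar t - xbar s| <=
  Num.sqrt p%:R / (1 - rho) * `|F (col_mx (xbar s) t) - F (col_mx (xbar s) s)|.
Proof.
have /andP[rho0 rho1] := rho01.
rewrite mulrAC ler_pdivlMr ?subr_gt0// mulrC.
apply: le_trans (enorm_le_norm _).
apply: le_trans (ler_wpM2l _ (norm_le_enorm _)) _;
  first by rewrite subr_ge0 ltW.
rewrite mulrBl mul1r lerBlDl.
rewrite -{1}[xbar t]Fxbar -{1}[xbar s]Fxbar.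
apply: le_trans (ler_enorm_dist (F (col_mx (xbar s) t)) _ _) _.
by rewrite lerD2r conservative_jacobian_contraction.
Qed.

Lemma fixed_point_locally_lipschitz : locally_lipschitz xbar.
Proof.
have /andP[rho0 rho1] := rho01.
pose k := Num.sqrt p%:R / (1 - rho) + 1.
have k0 : 0 < k by rewrite ltr_wpDl// divr_ge0 ?sqrtr_ge0// subr_ge0 ltW.
have dist t s : `|xbar t - xbar s| <=
    k * `|F (col_mx (xbar s) t) - F (col_mx (xbar s) s)|.
  by rewrite (le_trans (fixed_point_dist _ _))// ler_wpM2r// lerDl.
apply/locally_lipschitzP => t0.
have [L L0 [U /nbhs_ballP[r /= r0 rU] LU]] :=
  iffLR (locally_lipschitzP _) F_lip (col_mx (xbar t0) t0).
have r20 : 0 < r / 2 by rewrite divr_gt0.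
exists (k * L); first exact: mulr_gt0.
(* Continuity of [xbar] at [t0] comes first, from [dist t t0]; it keeps the points
   [col_mx (xbar s) u] used below inside [U]. *)
exists [set t | `|t - t0| < r / 2 /\ `|xbar t - xbar t0| < r / 2].
  have Fc : continuous (fun t => F (col_mx (xbar t0) t)).
    move=> t; apply: (@continuous_comp _ _ _ (fun t => col_mx (xbar t0) t) F).
      by apply: continuous_col_mx => s; [exact: cst_continuous|exact: cvg_id].
    exact: locally_lipschitz_continuous.
  near=> t; split.
    rewrite distrC; near: t; apply: cvgr_dist_lt; last exact: r20.
    exact: cvg_id.
  apply: le_lt_trans (dist t t0) _; rewrite -ltr_pdivlMl// distrC mulrC.
  near: t; apply: cvgr_dist_lt; last by rewrite divr_gt0.
  exact: Fc.
move=> t s [tr xtr] [sr xsr].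
apply: le_trans (dist t s) _; rewrite -mulrA ler_wpM2l ?(ltW k0)//.
have inU u : `|u - t0| < r / 2 -> U (col_mx (xbar s) u).
  move=> ur; apply: rU; rewrite -ball_normE/= distrC opp_col_mx add_col_mx.
  by rewrite (le_lt_trans (norm_col_mx_le _ _))// (splitr r) ltrD.
apply: le_trans (LU _ _ (inU _ tr) (inU _ sr)) _; rewrite ler_wpM2l ?(ltW L0)//.
rewrite opp_col_mx add_col_mx subrr (le_trans (norm_col_mx_le _ _))//.
by rewrite normr0 add0r.
Unshelve. all: by end_near. Qed.

Local Notation J theta := (JF (col_mx (xbar theta) theta)).

Let graph_continuous : continuous (fun theta => col_mx (xbar theta) theta).
Proof.
apply: continuous_col_mx => t; last exact: cvg_id.
exact/locally_lipschitz_continuous/fixed_point_locally_lipschitz.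
Qed.

Let J_rho theta V : J theta V -> opnorm (lsubmx V) <= rho.
Proof. exact: JF_contr. Qed.

Let J_closed : closed [set tV | J tV.1 tV.2].
Proof.
have [_ JFcl _ _ _] := F_JF.
pose f (tV : 'cV[R]_m * 'M[R]_(p, p + m)) := (col_mx (xbar tV.1) tV.1, tV.2).
have fc : continuous f.
  apply: continuous_pair => z; last exact: cvg_snd.
  apply: (@continuous_comp _ _ _ fst (fun theta => col_mx (xbar theta) theta)).
    exact: cvg_fst.
  exact: graph_continuous.
by move/continuous_closedP : fc => /(_ _ JFcl).
Qed.

Let J_bounded (theta : 'cV[R]_m) :
  exists b : R, \forall t \near theta, forall V, J t V -> `|V| <= b.
Proof.
have [_ _ /(_ (col_mx (xbar theta) theta)) [U zU /bounded_setP[b Ub]] _ _] :=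
  F_JF.
have tU : \forall t \near theta, U (col_mx (xbar t) t) := graph_continuous zU.
by exists b; apply: filterS tU => t Ut V JV; apply: Ub;
  exists (col_mx (xbar t) t).
Qed.

Let J_compact theta : compact (J theta).
Proof.
apply: bounded_closed_compact_mx.
  by have [b /nbhs_singleton Jb] := J_bounded theta; apply/bounded_setP;
    exists b.
have fc : continuous (fun V : 'M[R]_(p, p + m) => (theta, V)).
  by apply: (@continuous_pair _ 'cV[R]_m _ (cst theta) id) => y;
    [exact: cst_continuous|exact: cvg_id].
by move/continuous_closedP : fc => /(_ _ J_closed).
Qed.

Let J_neq0 theta : J theta !=set0.
Proof. by have [_ _ _ + _] := F_JF; exact. Qed.

Lemma fixed_point_fix_domain theta : fix_domain (J theta).
Proof.
split => //; exists rho; first by case/andP: rho01.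
by move=> A B JAB; rewrite -(row_mxKl A B); exact: J_rho JAB.
Qed.

Lemma fixed_point_fix_unique theta : exists! X, is_fix (J theta) X.
Proof.
have [X Xf] := is_fix_exists rho01 (@J_rho theta) (J_neq0 theta)
  (@J_compact theta).
exists X; split => // Y Yf.
exact: (is_fix_unique rho01 (@J_rho theta) Xf Yf).
Qed.

Let fixP theta : [/\ fix_set (J theta) !=set0, compact (fix_set (J theta)) &
  fix_set (J theta) = affine_step (J theta) (fix_set (J theta))].
Proof.
exact/is_fixE/(fix_setP rho01 (@J_rho theta) (J_neq0 theta) (@J_compact theta)).
Qed.

Let fix_sub theta :
  fix_set (J theta) `<=` affine_step (J theta) (fix_set (J theta)).
Proof. by have [_ _ <-] := fixP theta. Qed.

(** The invariant radius depends on [J t] only through its bound [b], which is uniform near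
    [theta]. *)
Let fix_bounded (theta : 'cV[R]_m) :
  exists b : R, \forall t \near theta, forall W, fix_set (J t) W -> `|W| <= b.
Proof.
have [b Jb] := J_bounded theta.
exists `|Num.sqrt p%:R * b / (1 - rho)|; near=> t => W fW.
apply: norm_le_col => // j; apply: le_trans (ler_norm _).
apply: (affine_invariant_bound rho01 (@J_rho t) _ _ (@fix_sub t)) => //.
  by near: t.
by have [_ /compact_bounded ? _] := fixP t.
Unshelve. all: by end_near. Qed.

Lemma fixed_point_fix_closed : closed [set tX | fix_set (J tX.1) tX.2].
Proof.
set G := [set _ | _]; move=> [theta Z] clZ.
have [b Jb] := J_bounded theta; have [c Gc] := fix_bounded theta.
have [fix0 fixc fixE] := fixP theta.
apply: (@affine_invariant_sub _ _ _ (J theta) rho rho01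
  (@J_rho theta) [set W | closure G (theta, W)]) clZ => //.
(* A limit point [W] lies within distance 1 of an element of some neighbouring fixed set, itself
   bounded by [c]. *)
- apply/bounded_setP; exists (c + 1) => W clW.
  have [[t W'] [GW' [/= tc W1]]] :
      G `&` ([set t | forall W, fix_set (J t) W -> `|W| <= c] `*` ball W 1)
        !=set0.
    apply: clW.
    exists ([set t | forall W, fix_set (J t) W -> `|W| <= c], ball W 1) => //.
    by split => //; exact: nbhsx_ballx.
  rewrite -(subrK W' W) addrC (le_trans (ler_normD _ _))// lerD//;
    first exact: tc.
  by move: W1; rewrite -ball_normE => /ltW.
- move=> W; apply: (closure_affine_invariant (J := fun t => J t)
    (M := Num.max b c)) => //.
  + near=> t => V JV; rewrite le_max; apply/orP; left.
    by move: V JV; near: t.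
  + near=> t => V JV; rewrite le_max; apply/orP; right.
    by move: V JV; near: t.
- by apply: compact_closed; [exact: norm_hausdorff|exact: fixc].
- by rewrite /= -fixE.
Unshelve. all: by end_near. Qed.

Lemma fixed_point_chain_rule :
  chain_rule_along_curves xbar (fun theta => fix_set (J theta)).
Proof.
move=> g gac; have [_ _ _ _ chain] := F_JF.
have xgac := abs_continuous_comp fixed_point_locally_lipschitz gac.
(* The chain rule of [F] is used along the lifted curve; since [F] sends it to [xbar \o g], one null
   set serves all elements of the fixed set. *)
move: (chain _ (abs_continuous_col_mx xgac gac)); apply: filterS;
  first exact: (ae_filter_ringOfSetsType lebesgue_measure).
move=> t H /H{H}[].
have -> : F \o (fun t => col_mx ((xbar \o g) t) (g t)) = xbar \o g.
  by apply/funext => s; rewrite /= Fxbar.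
move=> /derivable_col_mx[Dxg Dg] _; rewrite derive_col_mx// => DV;
  split => // X fX.
set h' := 'D_1 (xbar \o g) t; set g' := 'D_1 g t.
apply/esym/eqP; rewrite -subr_eq0; apply/eqP/enorm_eq0.
(* The bound must be uniform over the fixed set, because each unrolling replaces the current element
   by another one. *)
have [D fD] : exists D, forall W, fix_set (J (g t)) W ->
  enorm (W *m g' - h') <= D.
  have mc : continuous (fun W : 'M[R]_(p, m) => enorm (W *m g' - h')).
    have Ac : continuous (fun W : 'M[R]_(p, m) => W *m g').
      by apply: (@continuous_mulmx _ _ _ _ _ id (cst g')) => y;
        [exact: cvg_id|exact: cst_continuous].
    move=> W; apply: (@continuous_comp _ _ _
      (fun W : 'M[R]_(p, m) => W *m g' - h') (@enorm R p)).
      exact: (cvgB (Ac W) (@cvg_cst _ h' _ (nbhs W) _)).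
    exact: enorm_continuous.
  have [f0 fc _] := fixP (g t).
  have [W _ Wmax] := compact_EVT_max f0 fc (continuous_subspaceT mc).
  by exists (enorm (W *m g' - h')) => W' fW'; apply: Wmax; rewrite inE.
apply/eqP; rewrite eq_le enorm_ge0 andbT.
apply: (@le_geometric_addl _ rho D _ _ rho01) => n; rewrite addr0.
elim: n X fX => [|n IH] X fX; first by rewrite expr0 mul1r fD.
have [V [W [JV fW ->]]] := fix_sub fX.
have -> : (lsubmx V *m W + rsubmx V) *m g' - h' = lsubmx V *m (W *m g' - h').
  have {1}-> : h' = lsubmx V *m h' + rsubmx V *m g'
    by rewrite -mul_row_col hsubmxK -DV.
  by rewrite mulmxDl mulmxBr mulmxA opprD addrACA subrr addr0.
by rewrite exprS -mulrA; apply: enorm_mulmx_le; [exact: J_rho JV|exact: IH].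
Qed.

Lemma fixed_point_conservative_jacobian :
  conservative_jacobian xbar (fun theta => fix_set (J theta)).
Proof.
split.
- exact: fixed_point_locally_lipschitz.
- exact: fixed_point_fix_closed.
- move=> theta; have [b fb] := fix_bounded theta.
  exists [set t | forall W, fix_set (J t) W -> `|W| <= b] => //.
  by apply/bounded_setP; exists b => W [t tb fW]; exact: tb.
- by move=> theta; have [] := fixP theta.
- exact: fixed_point_chain_rule.
Qed.

End implicit_fixed_point.

Theorem theorem2 (R : realType) (p m : nat)
    (F : 'cV[R]_(p + m) -> 'cV[R]_p)
    (JF : 'cV[R]_(p + m) -> set 'M[R]_(p, p + m)) (rho : R)
    (F_lip : locally_lipschitz F)
    (F_pd : path_differentiable F)
    (F_JF : conservative_jacobian F JF)
    (rho_ge0 : 0 <= rho) (rho_lt1 : rho < 1)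
    (JF_contr : forall (x : 'cV[R]_p) (theta : 'cV[R]_m)
        (A : 'M[R]_p) (B : 'M[R]_(p, m)),
      JF (col_mx x theta) (row_mx A B) -> opnorm A <= rho) :
  (forall theta : 'cV[R]_m, exists! x : 'cV[R]_p, F (col_mx x theta) = x) /\
  (forall xbar : 'cV[R]_m -> 'cV[R]_p,
    (forall theta, F (col_mx (xbar theta) theta) = xbar theta) ->
    (forall theta,
      fix_domain (JF (col_mx (xbar theta) theta)) /\
      exists! X : set 'M[R]_(p, m), is_fix (JF (col_mx (xbar theta) theta)) X) /\
    conservative_jacobian xbar
      (fun theta => fix_set (JF (col_mx (xbar theta) theta)))).
Proof.
have rho01 : 0 <= rho < 1 by rewrite rho_ge0.
have ctr z V : JF z V -> opnorm (lsubmx V) <= rho.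
  by rewrite -[z]vsubmxK -{1}[V]hsubmxK; exact: JF_contr.
split=> [theta|xbar Fxbar]; first exact: fixed_point_exists_unique F_JF rho01
  ctr theta.
split=> [theta|]; last exact: (fixed_point_conservative_jacobian F_JF rho01 ctr
  Fxbar).
split; first exact: (fixed_point_fix_domain F_JF rho01 ctr Fxbar).
exact: (fixed_point_fix_unique F_JF rho01 ctr Fxbar).
Qed.
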